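(* Let $\Gamma$ be a type-I strongly regular graph with $v$ vertices. Suppose that $$0 < \operatorname{frac}\left(\sqrt{v}/2\right) < \frac14 + \frac{\sqrt{v}-\sqrt{v+5/4}}{2}.$$ Then $\omega(\Gamma) \leqslant \lfloor \sqrt{v} - 1 \rfloor$.
   Context: Graphs are finite, simple and undirected. The clique number $\omega(\Gamma)$ is the maximum cardinality of a clique in $\Gamma$. A non-empty (having at least one edge) $k$-regular graph on $v$ vertices is edge-regular with parameters $(v,k,\lambda)$ if every pair of adjacent vertices has precisely $\lambda$ common neighbours. A strongly regular graph with parameters $(v,k,\lambda,\mu)$ is a non-complete edge-regular graph with parameters $(v,k,\lambda)$ such that every pair of distinct non-adjacent vertices has precisely $\mu$ common neighbours. A strongly regular graph is type I (a conference graph) if $k=(v-1)/2$, $\lambda=(v-5)/4$ and $\mu=(v-1)/4$. For a real number $a$, $\operatorname{frac}(a) := a - \lfloor a \rfloor$. *)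

(* Defs.v *)
From mathcomp Require Import all_boot all_order all_algebra.
From mathcomp Require Import reals.

Set Implicit Arguments.
Unset Strict Implicit.
Unset Printing Implicit Defensive.

Import Order.TTheory GRing.Theory Num.Theory.
Local Open Scope ring_scope.

Record sgraph := SGraph {
  vertex :> finType;
  adj : rel vertex;
  adj_sym : symmetric adj;
  adj_irrefl : irreflexive adj }.

Section Graphs.
Variable G : sgraph.

Definition clique (A : {set G}) : bool :=
  [forall x in A, forall y in A, (x != y) ==> adj x y].

Definition clique_number : nat := (\max_(A : {set G} | clique A) #|A|)%N.

Definition neighbours (x : G) : {set G} := [set y | adj x y].

Definition common_neighbours (x y : G) : {set G} :=
  neighbours x :&: neighbours y.

Definition regular (k : nat) : Prop := forall x : G, #|neighbours x| = k.

Definition nonempty : Prop := exists x y : G, adj x y.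

Definition complete : Prop := forall x y : G, x != y -> adj x y.

Definition edge_regular (v k lambda : nat) : Prop :=
  [/\ nonempty, #|G| = v, regular k &
      forall x y : G, adj x y -> #|common_neighbours x y| = lambda].

Definition strongly_regular (v k lambda mu : nat) : Prop :=
  [/\ ~ complete, edge_regular v k lambda &
      forall x y : G, x != y -> ~~ adj x y -> #|common_neighbours x y| = mu].

(* The parameter equations are stated in rat, where / is exact division and
   - is not truncated. *)
Definition type_I_srg (v : nat) : Prop :=
  exists k lambda mu : nat,
    [/\ strongly_regular v k lambda mu,
        k%:R = (v%:R - 1) / 2 :> rat,
        lambda%:R = (v%:R - 5) / 4 :> rat &
        mu%:R = (v%:R - 1) / 4 :> rat].

End Graphs.

Definition frac_part (R : realType) (a : R) : R := a - (Num.floor a)%:~R.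

(* Main.v *)
Require Import Defs.
From mathcomp Require Import all_boot all_order all_algebra.
From mathcomp Require Import reals.
From mathcomp Require Import zify ring lra.

(** Fix a clique [S] of size [c] in an edge-regular graph, and let [d z] be the
    number of neighbours in [S] of a vertex [z].  Counting edges, and paths of
    length two, with ends in [S] determines the sums of [d z] and of [d z ^ 2]
    over the vertices [z] outside [S] in terms of [v], [k], [lambda] and [c].
    Since no integer lies strictly between [x] and [x + 1], every term
    [(d z - x) (d z - x - 1)] is nonnegative; their sum over the vertices
    outside [S] is the clique adjacency polynomial
    [x (x + 1) (v - c) - 2 x c (k - c + 1) + c (c - 1) (lambda - c + 2)],
    so this is nonnegative for every integer [x] ([clique_adjacency_bound]).

    For the parameters of a conference graph and [c = 2 m], the mean of [d]
    outside [S] is slightly below [m], which suggests [x = m - 1]; the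
    polynomial then factors as [m (v + 1 - 4 m ^ 2 - 2 m) / 2].  Hence there is
    no clique of size [2 m] as soon as [v + 1 < 4 m ^ 2 + 2 m]
    ([conference_no_even_clique]).

    Take [m = floor (sqrt v / 2)].  The hypothesis on the fractional part
    rearranges to [sqrt (v + 5 / 4) < 2 m + 1 / 2], whose square is exactly
    [v + 1 < 4 m ^ 2 + 2 m].  So the clique number is less than [2 m], and
    [2 m <= sqrt v]. *)

Set Implicit Arguments.
Unset Strict Implicit.
Unset Printing Implicit Defensive.

Import Order.TTheory GRing.Theory Num.Theory.
Local Open Scope ring_scope.

Section CliqueCounting.
Variable G : sgraph.
Implicit Types (S T : {set G}) (z s t : G).

Lemma cliqueP S :
  reflect {in S &, forall s t, s != t -> adj s t} (clique S).
Proof.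
apply: (iffP forall_inP) => [cS s t sS tS | cS s sS].
  by move/forall_inP: (cS s sS) => /(_ t tS)/implyP.
by apply/forall_inP => t tS; apply/implyP; apply: cS.
Qed.

Lemma clique_sub S T : T \subset S -> clique S -> clique T.
Proof.
move=> /subsetP sTS /cliqueP cS; apply/cliqueP => s t sT tT.
by apply: cS; apply: sTS.
Qed.

Lemma clique_of_size n :
  (n <= clique_number G)%N -> exists2 S : {set G}, clique S & #|S| = n.
Proof.
have c0 : clique (set0 : {set G}) by apply/cliqueP => s t; rewrite inE.
have [S cS eS] := eq_bigmax_cond (fun S : {set G} => #|S|)
  (ltac:(by apply/card_gt0P; exists set0) : (0 < #|@clique G|)%N).
rewrite /clique_number eS => le_nS.
have [T sTS cardT] : exists2 T : {set G}, T \subset S & #|T| = n.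
  have [s [s_uniq s_size sS]] := card_geqP le_nS.
  exists [set z in s].
    by apply/subsetP => z; rewrite inE; apply: sS.
  by rewrite cardsE -s_size; apply/card_uniqP.
by exists T => //; apply: clique_sub sTS cS.
Qed.

Definition deg_in S z : nat := #|neighbours z :&: S|.

Lemma deg_inE S z : deg_in S z = (\sum_(s in S) adj z s)%N.
Proof.
rewrite /deg_in -sum1_card [RHS]big_mkcond [LHS]big_mkcond /=.
by apply: eq_bigr => s _; rewrite !inE; case: (s \in S); case: (adj z s).
Qed.

Lemma card_common_neighboursE s t :
  #|common_neighbours s t| = (\sum_z adj z s * adj z t)%N.
Proof.
rewrite -sum1_card big_mkcond; apply: eq_bigr => z _.
by rewrite !inE !(@adj_sym _ z); case: (adj s z); case: (adj t z).
Qed.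

Lemma sum_deg_in S : (\sum_z deg_in S z = \sum_(s in S) #|neighbours s|)%N.
Proof.
under eq_bigr do rewrite deg_inE.
rewrite exchange_big; apply: eq_bigr => s _ /=.
rewrite -sum1_card [RHS]big_mkcond; apply: eq_bigr => z _.
by rewrite inE adj_sym; case: adj.
Qed.

(** Both sides count the walks [s, z, t] with [s] and [t] in [S], where [s = t]
    is allowed. *)
Lemma sum_deg_in_sqr S :
  (\sum_z deg_in S z ^ 2 =
   \sum_(s in S) \sum_(t in S) #|common_neighbours s t|)%N.
Proof.
under [RHS]eq_bigr do under eq_bigr do rewrite card_common_neighboursE.
under [RHS]eq_bigr do rewrite exchange_big.
rewrite [RHS]exchange_big; apply: eq_bigr => z _ /=.
rewrite deg_inE -mulnn big_distrl; apply: eq_bigr => s _ /=.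
by rewrite big_distrr.
Qed.

Lemma deg_in_clique S z : clique S -> z \in S -> deg_in S z = #|S|.-1.
Proof.
move=> /cliqueP cS zS; rewrite (cardsD1 z S) zS /deg_in /=.
apply: eq_card => s; rewrite !inE.
have [-> | ne_sz] := eqVneq s z; first by rewrite adj_irrefl.
by case: (boolP (s \in S)) => sS; rewrite ?andbF // cS // eq_sym.
Qed.

Section EdgeRegular.
Variables (v k lambda : nat).
Hypothesis erG : edge_regular G v k lambda.

(** The pairs [s = t] contribute the degree [k], the others are adjacent and
    contribute [lambda]. *)
Lemma sum_deg_in_sqr_clique S : clique S ->
  (\sum_z deg_in S z ^ 2 = #|S| * (k + #|S|.-1 * lambda))%N.
Proof.
case: erG => _ _ kG lG cS; have /cliqueP adjS := cS.
rewrite sum_deg_in_sqr -sum_nat_const; apply: eq_bigr => s sS.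
rewrite (bigD1 s) //= [common_neighbours s s]setIid kG; congr (_ + _)%N.
have -> : #|S|.-1 = #|S :\ s| by rewrite (cardsD1 s S) sS.
rewrite -sum_nat_const; apply: eq_big => [t | t /andP[tS ne_ts]].
  by rewrite !inE andbC.
by apply: lG; apply: adjS; rewrite // eq_sym.
Qed.

(** The polynomial is the sum of [(d z - x) (d z - x - 1)] over the vertices [z]
    outside [S], and a product of consecutive integers is nonnegative. *)
Lemma clique_adjacency_bound S (c x : int) : clique S -> c = #|S|%:Z ->
  0 <= x * (x + 1) * (v%:Z - c) - 2 * x * c * (k%:Z - c + 1)
       + c * (c - 1) * (lambda%:Z - c + 2).
Proof.
move=> cS def_c; case: (erG) => _ vG kG _.
pose d z := (deg_in S z)%:Z.
have d_in z : z \in S -> d z = c - 1.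
  move=> zS; rewrite /d deg_in_clique // def_c.
  by have : (0 < #|S|)%N by [apply/card_gt0P; exists z]; lia.
(* The moments of d are easiest over all vertices; the terms in S, where
   d is constant, are subtracted afterwards. *)
have sum1 : \sum_(z : G) (1 : int) = v%:Z by rewrite sumr_const vG natz.
have sumd : \sum_z d z = c * k%:Z.
  under eq_bigr do rewrite /d -natz.
  rewrite -natr_sum natz sum_deg_in (eq_bigr (fun=> k)) // sum_nat_const.
  by rewrite PoszM def_c.
have sumdd : \sum_z d z ^+ 2 = c * (k%:Z + c * lambda%:Z - lambda%:Z).
  under eq_bigr do rewrite /d -natz -natrX.
  rewrite -natr_sum natz sum_deg_in_sqr_clique // def_c.
  by case: #|S| => [|n] /=; lia.
pose f z := (d z - x) * (d z - x - 1).
have f_ge0 z : 0 <= f z by rewrite /f; case: (lerP (d z) x) => d_x; nia.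
have sumf : \sum_z f z =
    c * (k%:Z + c * lambda%:Z - lambda%:Z) - (2 * x + 1) * (c * k%:Z)
    + x * (x + 1) * v%:Z.
  rewrite -sumdd -sumd -sum1 !mulr_sumr -sumrB -big_split /=.
  by apply: eq_bigr => z _; rewrite /f; ring.
have sumf_in : \sum_(z in S) f z = c * ((c - 1 - x) * (c - 1 - x - 1)).
  rewrite (eq_bigr (fun=> (c - 1 - x) * (c - 1 - x - 1))) => [|z zS].
    by rewrite sumr_const def_c -[_ *+ _]mulr_natl natz.
  by rewrite /f d_in.
have : 0 <= \sum_(z | z \notin S) f z by apply: sumr_ge0.
move: sumf; rewrite (bigID (mem S)) /= sumf_in => /(canRL (addKr _)) ->.
by congr (0 <= _); ring.
Qed.

(** The clique adjacency polynomial at [x = m - 1], [c = 2 m], with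
    [k = (v - 1) / 2] and [lambda = (v - 5) / 4], is
    [m (v + 1 - 4 m ^ 2 - 2 m) / 2]. *)
Lemma conference_no_even_clique S (m : int) :
    v%:Z = 2 * k%:Z + 1 -> v%:Z = 4 * lambda%:Z + 5 ->
    v%:Z + 1 < 4 * m ^+ 2 + 2 * m -> clique S -> #|S|%:Z <> 2 * m.
Proof.
move=> vk vl v_lt cS cardS.
have m_gt0 : 0 < m by have : 0 <= m by [lia]; nia.
have kE : k%:Z = 2 * lambda%:Z + 2 by lia.
have := clique_adjacency_bound (m - 1) cS (erefl _).
rewrite cardS kE vl (_ : _ + _ = m * (2 * lambda%:Z + 3 - 2 * m ^+ 2 - m)).
  by rewrite pmulr_rge0 //; lia.
by ring.
Qed.

End EdgeRegular.
End CliqueCounting.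

Lemma type_I_srg_parameters (G : sgraph) (v : nat) : type_I_srg G v ->
  exists k lambda : nat, [/\ edge_regular G v k lambda,
    v%:Z = 2 * k%:Z + 1 & v%:Z = 4 * lambda%:Z + 5].
Proof.
case=> k [lambda] [mu] [[_ erG _] kE lambdaE _]; exists k, lambda.
have vk : v%:R = (2 * k + 1)%:R :> rat by rewrite natrD natrM kE; field.
have vl : v%:R = (4 * lambda + 5)%:R :> rat.
  by rewrite natrD natrM lambdaE; field.
move: vk vl => /eqP + /eqP; rewrite !eqr_nat => /eqP vk /eqP vl.
by split=> //; lia.
Qed.

(** In terms of [m = floor (sqrt v / 2)] the hypothesis says
    [sqrt (v + 5 / 4) < 2 m + 1 / 2]; squaring gives the conclusion. *)
Lemma frac_bound_sqr (R : realType) (v : nat)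
    (m := Num.floor (Num.sqrt (v%:R : R) / 2)) :
    frac_part (Num.sqrt (v%:R : R) / 2)
      < 1 / 4 + (Num.sqrt (v%:R : R) - Num.sqrt (v%:R + 5 / 4)) / 2 ->
  v%:Z + 1 < 4 * m ^+ 2 + 2 * m.
Proof.
rewrite /frac_part -/m => frac_lt.
have v_ge0 : 0 <= v%:R + 5 / 4 :> R by have := ler0n R v; lra.
have s_ge0 := sqrtr_ge0 (v%:R + 5 / 4 : R).
have s_lt : Num.sqrt (v%:R + 5 / 4) < 2 * m%:~R + 1 / 2 :> R by lra.
have := sqr_sqrtr v_ge0; set s := Num.sqrt _ in s_ge0 s_lt * => s2.
rewrite -(ltr_int R) expr2 !intrD !intrM -[v%:~R]pmulrn.
by nra.
Qed.

Theorem theorem2p1 (R : realType) (G : sgraph) (v : nat) :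
  type_I_srg G v ->
  0 < frac_part (Num.sqrt (v%:R : R) / 2)
    < 1 / 4 + (Num.sqrt (v%:R : R) - Num.sqrt (v%:R + 5 / 4)) / 2 ->
  (clique_number G)%:Z <= Num.floor (Num.sqrt (v%:R : R) - 1).
Proof.
move=> /type_I_srg_parameters[k [lambda [erG vk vl]]] /andP[_ /frac_bound_sqr].
set m := Num.floor _ => v_lt.
have m_ge0 : 0 <= m by rewrite floor_ge0 divr_ge0 ?sqrtr_ge0.
have omega_lt : (clique_number G)%:Z < 2 * m.
  rewrite ltNge; apply/negP => le_omega.
  have [|S cS cardS] := @clique_of_size G (2 * `|m|)%N; first by lia.
  by apply: (conference_no_even_clique erG vk vl v_lt cS); lia.
have m_le : m%:~R <= Num.sqrt (v%:R : R) / 2 by apply: floor_le.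
have : ((clique_number G)%:Z + 1)%:~R <= (2 * m)%:~R :> R.
  by rewrite ler_int; lia.
by rewrite floor_ge_int intrD intrM; lra.
Qed.
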